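(* Let $D$ be a connected mixed graph and $\alpha\in\mathbb{C}$ with $|\alpha|=1$. Then $D$ is an $\alpha$-monograph of first kind if and only if $V(D)$ can be partitioned into sets $V_z$, indexed by $z\in\{\alpha^j: j\in\mathbb{Z}\}$ (some possibly empty), such that there is no digon between vertices of two different sets, and every arc starting in a set $V_{\alpha^j}$ ends in $V_{\alpha^{j-1}}$.
   Context: A mixed graph $D$ is obtained from a finite simple undirected graph $\Gamma(D)$ by replacing some edges by arcs: between any two adjacent vertices $u,v$ there is exactly one of a digon $u\sim v$, an arc $u\to v$ (starting at $u$, ending at $v$), or an arc $v\to u$; connectedness and cycles refer to $\Gamma(D)$. For $|\alpha|=1$ set $h_{uv}=1$ if $u\sim v$, $\alpha$ if $u\to v$, $\bar\alpha$ if $v\to u$. A mixed walk $W=v_1,\dots,v_k$ has value $h_\alpha(W)=h_{v_1v_2}\cdots h_{v_{k-1}v_k}$. For a cycle $C$ with vertices $v_1,\dots,v_\ell$ in cyclic order, a traversal $\vec C$ is the closed walk $v_1,\dots,v_\ell,v_1$ (either direction, any start). $D$ is an $\alpha$-monograph of first kind if $h_\alpha(\vec C)=1$ for every cycle $C$ and every traversal $\vec C$. *)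

(* Defs.v *)
From mathcomp Require Import all_boot all_order all_algebra.
From mathcomp Require Import complex.
From mathcomp Require Import classical_sets reals.

Set Implicit Arguments.
Unset Strict Implicit.
Unset Printing Implicit Defensive.

Import Order.TTheory GRing.Theory Num.Theory.

Local Open Scope ring_scope.

(* [mg_adj] is the underlying undirected graph; [mg_arc u v] says that the edge uv
   has been replaced by an arc starting at u and ending at v. *)
Record mixed_graph (T : finType) := MixedGraph {
  mg_adj : rel T;
  mg_arc : rel T;
  mg_adj_sym : symmetric mg_adj;
  mg_adj_irr : irreflexive mg_adj;
  mg_arc_adj : subrel mg_arc mg_adj;
  mg_arc_asym : forall u v, mg_arc u v -> ~~ mg_arc v u
}.

Definition digon (T : finType) (D : mixed_graph T) : rel T :=
  fun u v => [&& mg_adj D u v, ~~ mg_arc D u v & ~~ mg_arc D v u].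

Definition mconnected (T : finType) (D : mixed_graph T) : Prop :=
  forall u v : T, connect (mg_adj D) u v.

(* The value on non-adjacent pairs is a dummy: it is never met along a walk. *)
Definition hval (R : realType) (T : finType) (D : mixed_graph T)
    (alpha : R[i]) (u v : T) : R[i] :=
  if digon D u v then 1
  else if mg_arc D u v then alpha
  else if mg_arc D v u then alpha^*
  else 0.

(* [pairmap h x s] lists the h-values of the consecutive pairs of x :: s. *)
Definition walk_value (R : realType) (T : finType) (D : mixed_graph T)
    (alpha : R[i]) (W : seq T) : R[i] :=
  if W is x :: s then \prod_(a <- pairmap (hval D alpha) x s) a else 1.

Definition is_cycle (T : finType) (D : mixed_graph T) (c : seq T) : Prop :=
  ucycle (mg_adj D) c /\ (2 < size c)%N.

(* v_1, ..., v_l is sent to the closed walk v_1, ..., v_l, v_1. *)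
Definition close_walk (T : finType) (c : seq T) : seq T :=
  if c is x :: s then rcons (x :: s) x else [::].

Definition traversal (T : finType) (c W : seq T) : Prop :=
  exists n : nat, W = close_walk (rot n c) \/ W = close_walk (rot n (rev c)).

Definition monograph1 (R : realType) (T : finType) (D : mixed_graph T)
    (alpha : R[i]) : Prop :=
  forall c W : seq T,
    is_cycle D c -> traversal c W -> walk_value D alpha W = 1.

Definition powers (R : realType) (alpha : R[i]) : set R[i] :=
  range (fun j : int => alpha ^ j).

(* Main.v *)
Require Import Defs.
From mathcomp Require Import all_boot all_order all_algebra.
From mathcomp Require Import complex.
From mathcomp Require Import classical_sets reals.

Import Order.TTheory GRing.Theory Num.Theory.

Local Open Scope classical_set_scope.
Local Open Scope ring_scope.

(** The first-kind condition says that [h] has trivial holonomy. A closed walk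
    with a repeated vertex splits into two shorter closed walks, and one
    without is a single vertex, an edge run back and forth, or a cycle; so the
    value of every closed walk is 1. On a connected graph this means that [h]
    is a coboundary: [h u v = f u / f v] for a potential [f] with values in the
    powers of [alpha]. The sets [V z] are the level sets of such an [f]. *)

(** Supplies a vertex [y] at which a closed walk is cut into two closed walks. *)
Lemma not_uniq_split (T : eqType) (s : seq T) : ~~ uniq s ->
  exists y p1 p2 p3, s = p1 ++ y :: p2 ++ y :: p3.
Proof.
elim: s => //= x s IHs; rewrite negb_and negbK => /orP[|/IHs].
  by case/splitPr=> p2 p3; exists x, [::], p2, p3.
by case=> y [p1 [p2 [p3 ->]]]; exists y, (x :: p1), p2, p3.
Qed.

Section Potential.

Variables (R : realType) (T : finType) (D : mixed_graph T) (alpha : R[i]).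
Hypothesis halpha : `|alpha| = 1.

Local Notation adj := (mg_adj D).
Local Notation h := (hval D alpha).
Local Notation wval x s := (walk_value D alpha (x :: s)).

Lemma unit_norm_neq0 : alpha != 0.
Proof. by rewrite -normr_eq0 halpha oner_neq0. Qed.

(** Links the two descriptions of an arc: the factor [alpha] gained by a potential, and the drop of
    the exponent by one in the partition. *)
Lemma mulr_exprz_pred (j : int) : alpha * alpha ^ (j - 1) = alpha ^ j.
Proof. by rewrite -{1}[alpha]expr1z -expfzDr ?unit_norm_neq0 // addrC subrK. Qed.

Lemma conj_unit_norm : alpha^* = alpha^-1.
Proof. by rewrite invC_norm halpha expr1n invr1 mul1r. Qed.

Local Arguments walk_value : simpl never.

Lemma walk_value_nil x : wval x [::] = 1.
Proof. by rewrite /walk_value big_nil. Qed.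

Lemma walk_value_cons x y s : wval x (y :: s) = h x y * wval y s.
Proof. by rewrite /walk_value /= big_cons. Qed.

Lemma walk_value_cat x s1 s2 :
  wval x (s1 ++ s2) = wval x s1 * wval (last x s1) s2.
Proof. by rewrite /walk_value pairmap_cat big_cat. Qed.

Lemma hval_digon {u v} : digon D u v -> h u v = 1.
Proof. by rewrite /hval => ->. Qed.

Lemma hval_arc {u v} : mg_arc D u v -> h u v = alpha.
Proof. by rewrite /hval /digon => ->; rewrite andbF. Qed.

Lemma hval_arcV {u v} : mg_arc D v u -> h u v = alpha^-1.
Proof.
move=> avu; rewrite /hval /digon avu !andbF.
by rewrite (negbTE (mg_arc_asym avu)) conj_unit_norm.
Qed.

Variant adj_spec u v : Prop :=
  | AdjDigon of digon D u v
  | AdjArc of mg_arc D u v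
  | AdjArcV of mg_arc D v u.

Lemma adjP {u v} : adj u v -> adj_spec u v.
Proof.
move=> auv.
have [|Nuv] := boolP (mg_arc D u v); first exact: AdjArc.
have [|Nvu] := boolP (mg_arc D v u); first exact: AdjArcV.
by apply: AdjDigon; rewrite /digon auv Nuv Nvu.
Qed.

Lemma digon_sym : symmetric (digon D).
Proof. by move=> u v; rewrite /digon mg_adj_sym [X in _ && X]andbC. Qed.

(** On the unit circle [alpha^*] is [alpha^-1], so reversing a step inverts its value. This settles
    the closed walks that run an edge back and forth. *)
Lemma hval_opp {u v} : adj u v -> h u v * h v u = 1.
Proof.
case/adjP=> uv.
- by rewrite !hval_digon ?mulr1 // digon_sym.
- by rewrite (hval_arc uv) (hval_arcV uv) divff ?unit_norm_neq0.
- by rewrite (hval_arc uv) (hval_arcV uv) mulVf ?unit_norm_neq0.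
Qed.

Lemma hval_power {u v} : adj u v -> exists j : int, h u v = alpha ^ j.
Proof.
case/adjP=> uv; first by exists 0; rewrite hval_digon // expr0z.
  by exists 1; rewrite hval_arc // expr1z.
by exists (-1); rewrite hval_arcV // exprN1.
Qed.

Lemma walk_value_power x s : path adj x s -> exists j : int, wval x s = alpha ^ j.
Proof.
elim: s x => [|y s IHs] x /=; first by exists 0; rewrite walk_value_nil expr0z.
case/andP=> /hval_power[i hi] /IHs[j hj]; exists (i + j).
by rewrite walk_value_cons hi hj expfzDr ?unit_norm_neq0.
Qed.

Lemma monograph1_closed_walk : monograph1 D alpha ->
  forall x s, path adj x s -> last x s = x -> wval x s = 1.
Proof.
(* Induction on the length. As [s] leaves out the initial [x], the final return to [x] alone is not
   a repetition in [s]. *)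
move=> mono x s; have [n] := ubnP (size s); elim: n x s => // n IHn x s.
rewrite ltnS => les pxs lxs; have [us|] := boolP (uniq s); last first.
  case/not_uniq_split=> y [p1 [p2 [p3 def_s]]].
  move: pxs lxs les; rewrite {s}def_s -2!cat_rcons !cat_path !last_cat !last_rcons.
  rewrite !size_cat !size_rcons !addSn => /and3P[pp1 pp2 pp3] lx lts.
  (* The inner loop at [y] has value 1, and cutting it out leaves the closed walk
     [rcons p1 y ++ p3]. Both are shorter than [s] because [rcons p1 y] and [rcons p2 y] are
     nonempty. *)
  rewrite !walk_value_cat !last_rcons (IHn y (rcons p2 y)) ?last_rcons //; last first.
    rewrite size_rcons; apply: leq_trans lts.
    by rewrite addnS !ltnS addnCA leq_addr.
  rewrite mul1r; have := IHn x (rcons p1 y ++ p3).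
  rewrite walk_value_cat cat_path last_cat !last_rcons pp1 pp3; apply=> //.
  rewrite size_cat size_rcons; apply: leq_trans lts.
  by rewrite addSn addnS !ltnS leq_add2l leq_addl.
case/lastP: s us pxs lxs {les} => [|s y] us pxs; first by rewrite walk_value_nil.
rewrite last_rcons => def_y; rewrite {y}def_y in us pxs *.
(* The walk is now [x], then [s], then [x] again: a loop, an edge run back and forth, or a cycle
   with at least three vertices. *)
case: s us pxs => [|y [|z s]] us pxs.
- by move: pxs; rewrite /= mg_adj_irr.
- have /andP[axy _] : adj x y && true by case/andP: pxs => ->.
  by rewrite !walk_value_cons walk_value_nil mulr1 hval_opp.
apply: (mono (x :: y :: z :: s)); last by exists 0%N; left; rewrite rot0.
by split=> //; apply/andP; split; [exact: pxs | move: us; rewrite rcons_uniq].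
Qed.

Definition is_potential (f : T -> R[i]) : Prop :=
  (forall v, exists j : int, f v = alpha ^ j) /\
  (forall u v, adj u v -> f u = h u v * f v).

(** The potential at [v] is the value of a chosen walk from [v] to a fixed root [r]; trivial
    holonomy makes the choice irrelevant. *)
Lemma monograph1_potential : mconnected D -> monograph1 D alpha ->
  exists f, is_potential f.
Proof.
move=> conD /monograph1_closed_walk mono.
case: (pickP (fun _ : T => true)) => [r _|T0]; last first.
  by exists (fun=> 1); split=> [v|u]; [have := T0 v | have := T0 u].
have/fin_all_exists[p pP] v :
    exists p : seq T, path adj v p /\ last v p = r.
  by case/connectP: (conD v r) => p pp ->; exists p.
exists (fun v => wval v (p v)); split=> [v|u v auv].
  by apply: walk_value_power; case: (pP v).
have [pu lu] := pP u; have [pv lv] := pP v.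
(* Any walk q from r back to u closes up both u -> r and u -> v -> r. *)
case/connectP: (conD r u) => q pq lq.
have eu : wval u (p u) * wval r q = 1.
  rewrite -{1}lu -walk_value_cat; apply: mono; first by rewrite cat_path pu lu.
  by rewrite last_cat lu.
have ev : h u v * wval v (p v) * wval r q = 1.
  rewrite -walk_value_cons -{1}lv -[last v _]/(last u (v :: p v)) -walk_value_cat.
  by apply: mono; rewrite /= ?auv ?cat_path ?last_cat ?pv lv.
have q0 : wval r q != 0.
  by apply: contra_eq_neq eu => ->; rewrite mulr0 eq_sym oner_neq0.
by apply: (mulIf q0); rewrite eu ev.
Qed.

(** The quotients [f u / f v] telescope along the walk. *)
Lemma potential_walk_value {f x s} : is_potential f -> path adj x s ->
  f x = wval x s * f (last x s).
Proof.
case=> _ fh; elim: s x => [|y s IHs] x /=; first by rewrite walk_value_nil mul1r.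
by case/andP=> /fh -> /IHs ->; rewrite walk_value_cons mulrA.
Qed.

Lemma potential_neq0 f v : is_potential f -> f v != 0.
Proof. by case=> /(_ v)[j ->] _; rewrite expfz_neq0 // unit_norm_neq0. Qed.

(** On a closed walk, telescoping returns [f x] times the value of the walk, and [f x] can be
    cancelled, being a power of [alpha]. *)
Lemma potential_monograph1 f : is_potential f -> monograph1 D alpha.
Proof.
move=> fP c W [/andP[cyc _] _].
have closed c' : cycle adj c' -> walk_value D alpha (close_walk c') = 1.
  case: c' => [//|x s] /= pxs; apply: (mulIf (potential_neq0 f x fP)).
  by rewrite mul1r [RHS](potential_walk_value fP pxs) last_rcons.
case=> n [] ->; apply: closed; rewrite rot_cycle // rev_cycle.
by rewrite (eq_cycle (e' := adj)) // => u v; rewrite mg_adj_sym.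
Qed.

(** In one direction the parts are the fibres of [f]; in the other, [f v] is the index of the part
    that contains [v]. *)
Lemma potential_partition :
  (exists f, is_potential f) <->
  exists V : R[i] -> set T,
    [/\ cover (powers alpha) V = [set: T],
        trivIset (powers alpha) V,
        (forall (z w : R[i]) (u v : T),
           powers alpha z -> powers alpha w -> z <> w ->
           V z u -> V w v -> ~~ digon D u v)
      & (forall (j : int) (u v : T),
           V (alpha ^ j) u -> mg_arc D u v -> V (alpha ^ (j - 1)) v)].
Proof.
have a0 := unit_norm_neq0; split=> [[f [fpow fh]]|[V [covV trivV digV arcV]]].
  exists (fun z => [set v | f v = z]); split.
  - apply/seteqP; split=> // v _; have [j fv] := fpow v.
    by exists (f v) => //; exists j.
  - by move=> z w _ _ [v [/= <- <-]].
  - move=> z w u v _ _ zw /= fu fv; apply/negP => duv; apply: zw.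
    have [auv _] := andP duv.
    by rewrite -fu -fv (fh u v auv) hval_digon // mul1r.
  - move=> j u v /= fu auv; apply: (mulfI a0).
    by rewrite mulr_exprz_pred -fu (fh u v) ?(hval_arc auv) ?(mg_arc_adj auv).
have /fin_all_exists[g gP] v : exists j : int, V (alpha ^ j) v.
  have : cover (powers alpha) V v by rewrite covV.
  by case=> z [j _ <-] Vv; exists j.
have pow (j : int) : powers alpha (alpha ^ j) by exists j.
(* If [alpha] is a root of unity, the exponent [g v] is not determined by the part of [v].
   Disjointness therefore identifies the powers [alpha ^ g v] and [alpha ^ (g u - 1)], not the
   exponents. *)
have arcE u v : mg_arc D u v -> alpha ^ g u = alpha * alpha ^ g v.
  move=> auv; have -> : alpha ^ g v = alpha ^ (g u - 1).
    by apply: trivV => //; exists v; split; [exact: gP | apply: arcV auv].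
  by rewrite mulr_exprz_pred.
exists (fun v => alpha ^ g v); split=> [v|u v]; first by exists (g v).
case/adjP=> uv.
- rewrite hval_digon // mul1r; apply/eqP/negPn/negP => /eqP Nuv.
  by have := digV _ _ _ _ (pow _) (pow _) Nuv (gP u) (gP v); rewrite uv.
- by rewrite (hval_arc uv) (arcE _ _ uv).
- by rewrite (hval_arcV uv) (arcE _ _ uv) mulKf.
Qed.

End Potential.

Theorem theorem5p9 (R : realType) (T : finType) (D : mixed_graph T)
    (alpha : R[i]) (hD : mconnected D) (halpha : `|alpha| = 1) :
  monograph1 D alpha <->
  exists V : R[i] -> set T,
    [/\ cover (powers alpha) V = [set: T],
        trivIset (powers alpha) V,
        (forall (z w : R[i]) (u v : T),
           powers alpha z -> powers alpha w -> z <> w ->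
           V z u -> V w v -> ~~ digon D u v)
      & (forall (j : int) (u v : T),
           V (alpha ^ j) u -> mg_arc D u v -> V (alpha ^ (j - 1)) v)].
Proof.
rewrite -(potential_partition _ _ _ _ halpha); split.
  exact: monograph1_potential.
by case=> f; apply: potential_monograph1.
Qed.
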